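(* Let $R(\mu_s,\mu_d)$ and $\tilde R(\mu_s,\mu_d)$ be the key generation rates defined in the context, as functions of the signal intensity $\mu_s$ and the decoy intensity $\mu_d$. Then, for a given $\mu_s$, both $\tilde R(\mu_s,\mu_d)$ and $R(\mu_s,\mu_d)$ are monotonically decreasing with respect to $\mu_d$.
   Context: $h(x)=-x\log_2 x-(1-x)\log_2(1-x)$ is the binary entropy. Parameters: $\alpha$ is the total transmission (including the quantum efficiency of the detector), $s$ is the error rate due to the imperfection of the optical system, $p_0$ is the detection rate of the vacuum pulse, $\eta$ is the efficiency of error correction ($1$ in the ideal case, $1.1$ in a realistic case), $\mu_s>0$ is the signal intensity and $\mu_d>0$ is the decoy intensity, with $\mu_d\ne\mu_s$. For $0<\mu_1<\mu_2$ define $$\hat a(\mu_1,\mu_2)=\frac{\mu_2^2e^{\mu_1}\big((1-e^{-\alpha\mu_1})+p_0(1-e^{-\mu_1})\big)-\mu_1^2e^{\mu_2}\big((1-e^{-\alpha\mu_2})+p_0(1-e^{-\mu_2})\big)}{\mu_1\mu_2(\mu_2-\mu_1)},$$ $$\hat b(\mu_1)=\frac{s(1-e^{-\alpha\mu_1})e^{\mu_1}+\frac{p_0}{2}(e^{\mu_1}-1)}{\mu_1},$$ $$\hat c(\mu_1,\mu_2)=\frac{\mu_2^2e^{\mu_1}\big((1-s)(1-e^{-\alpha\mu_1})+\frac{p_0}{2}(1-e^{-\mu_1})\big)-\mu_1^2e^{\mu_2}\big((1-s)(1-e^{-\alpha\mu_2})+\frac{p_0}{2}(1-e^{-\mu_2})\big)}{\mu_1\mu_2(\mu_2-\mu_1)}.$$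 Let $p_{s,+}=1-e^{-\alpha\mu_s}+p_0$ and let $e_{s,+}$ be defined by $e_{s,+}p_{s,+}=s(1-e^{-\alpha\mu_s})+\frac{p_0}{2}$. With $\mu_1=\min(\mu_s,\mu_d)$ the smaller and $\mu_2=\max(\mu_s,\mu_d)$ the larger of the two intensities, $$R(\mu_s,\mu_d)=\mu_se^{-\mu_s}\big(\hat c(\mu_1,\mu_2)+\hat b(\mu_1)\big)\Big(1-h\Big(\tfrac{\hat b(\mu_1)}{\hat c(\mu_1,\mu_2)+\hat b(\mu_1)}\Big)\Big)+e^{-\mu_s}p_0-p_{s,+}\,\eta\, h(e_{s,+}),$$ $$\tilde R(\mu_s,\mu_d)=\mu_se^{-\mu_s}\,\hat a(\mu_1,\mu_2)\Big(1-h\Big(\tfrac{\hat b(\mu_1)}{\hat a(\mu_1,\mu_2)}\Big)\Big)+e^{-\mu_s}p_0-p_{s,+}\,\eta\, h(e_{s,+}).$$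
   Formalization: For large μ_d the claim fails or h is undefined; strict decrease from μ_d to a larger μ_d' is proved when b̂/(ĉ+b̂) (for R), resp. b̂/â (for R̃), at μ_d' has nonzero denominator and lies in [0,1/2], with 0<α≤1, 0≤s≤1, p_0≥0. *)

(* Defs.v *)
(* Reals of the standard library; [ln x = 0] for [x <= 0], so [0 * log2 0 = 0]. *)
From Stdlib Require Export Reals.
Open Scope R_scope.

Definition log2 (x : R) : R := ln x / ln 2.

Definition binary_entropy (x : R) : R :=
  - x * log2 x - (1 - x) * log2 (1 - x).

Definition a_hat (alpha p0 mu1 mu2 : R) : R :=
  (mu2 ^ 2 * exp mu1 *
     ((1 - exp (- alpha * mu1)) + p0 * (1 - exp (- mu1)))
   - mu1 ^ 2 * exp mu2 *
     ((1 - exp (- alpha * mu2)) + p0 * (1 - exp (- mu2))))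
  / (mu1 * mu2 * (mu2 - mu1)).

Definition b_hat (alpha s p0 mu1 : R) : R :=
  (s * (1 - exp (- alpha * mu1)) * exp mu1 + p0 / 2 * (exp mu1 - 1)) / mu1.

Definition c_hat (alpha s p0 mu1 mu2 : R) : R :=
  (mu2 ^ 2 * exp mu1 *
     ((1 - s) * (1 - exp (- alpha * mu1)) + p0 / 2 * (1 - exp (- mu1)))
   - mu1 ^ 2 * exp mu2 *
     ((1 - s) * (1 - exp (- alpha * mu2)) + p0 / 2 * (1 - exp (- mu2))))
  / (mu1 * mu2 * (mu2 - mu1)).

Definition p_signal (alpha p0 mu_s : R) : R :=
  1 - exp (- alpha * mu_s) + p0.

(* The solution [e] of [e * p_signal = s (1 - exp (- alpha mu_s)) + p0 / 2];
   [p_signal] is positive when [0 < alpha], [0 < mu_s] and [0 <= p0]. *)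
Definition e_signal (alpha s p0 mu_s : R) : R :=
  (s * (1 - exp (- alpha * mu_s)) + p0 / 2) / p_signal alpha p0 mu_s.

(* In both rates below, [y] is the estimated single-photon detection rate and
   [b / y] the estimated single-photon phase error rate. *)

Definition yield_R (alpha s p0 mu_s mu_d : R) : R :=
  c_hat alpha s p0 (Rmin mu_s mu_d) (Rmax mu_s mu_d)
  + b_hat alpha s p0 (Rmin mu_s mu_d).

Definition yield_Rtilde (alpha p0 mu_s mu_d : R) : R :=
  a_hat alpha p0 (Rmin mu_s mu_d) (Rmax mu_s mu_d).

Definition key_rate (alpha s p0 eta mu_s mu_d : R) : R :=
  let b := b_hat alpha s p0 (Rmin mu_s mu_d) in
  let y := yield_R alpha s p0 mu_s mu_d in
  mu_s * exp (- mu_s) * y * (1 - binary_entropy (b / y))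
  + exp (- mu_s) * p0
  - p_signal alpha p0 mu_s * eta * binary_entropy (e_signal alpha s p0 mu_s).

Definition key_rate_tilde (alpha s p0 eta mu_s mu_d : R) : R :=
  let b := b_hat alpha s p0 (Rmin mu_s mu_d) in
  let y := yield_Rtilde alpha p0 mu_s mu_d in
  mu_s * exp (- mu_s) * y * (1 - binary_entropy (b / y))
  + exp (- mu_s) * p0
  - p_signal alpha p0 mu_s * eta * binary_entropy (e_signal alpha s p0 mu_s).

(* The estimated phase error rate exists and lies in [0, 1/2]; when [0 < b] this
   forces [0 < y].  As [mu_d] grows with the other parameters fixed, [y] tends to
   minus infinity (outside the degenerate case s = 1, p0 = 0).  Once [b / y]
   exceeds 1/2 the entropy is past its maximum, so that a worse estimate raises
   the rate, and further on the entropy is evaluated outside [0, 1]. *)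
Definition estimate_valid (y b : R) : Prop := y <> 0 /\ 0 <= b / y <= 1 / 2.

(* Main.v *)
(* With [K l x = (exp x - exp (l x)) / x = int_l^1 exp (t x) dt], all three
   estimates are built from functions [phi = u K (1 - alpha) + v K 0] with
   [u, v >= 0]: [b_hat] is the value of such a [phi] at the smaller intensity,
   while [a_hat] and [c_hat] are the intercepts at [0] of the secant of such a
   [phi] through the two intensities.  The intercept is symmetric, and strict
   convexity of [phi] makes it strictly decreasing in each intensity; [b_hat] is
   nondecreasing.

   Write the yield as [y = b + c], so that [c] is [c_hat] or [a_hat - b_hat],
   decreasing in both cases.  The quantity [y (1 - h (b / y)) ln 2] is the
   maximum over [0 < q < 1] of [b ln (2 q) + c ln (2 (1 - q))], attained at
   [q = b / y] (Gibbs' inequality).  At [q = b' / y' <= 1/2] the coefficient of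
   [b] is nonpositive and that of [c] nonnegative, so the rate drops when [b]
   grows and [c] decreases.  This avoids asking whether the yield
   [c_hat + b_hat] itself decreases, which can fail when [b / y > 1/2]. *)
Require Import Defs.
From Stdlib Require Import Reals Lra.
Open Scope R_scope.

Definition exp_diff_quot (l x : R) : R := (exp x - exp (l * x)) / x.

Definition exp_mix (alpha u v x : R) : R :=
  u * exp_diff_quot (1 - alpha) x + v * exp_diff_quot 0 x.

Definition intercept (f : R -> R) (x y : R) : R :=
  (y * f x - x * f y) / (y - x).

Definition strictly_convex_pos (f : R -> R) : Prop :=
  forall x y z, 0 < x -> x < y -> y < z ->
    (z - x) * f y < (z - y) * f x + (y - x) * f z.

(** * Exponential difference quotients: convexity and growth *)

Lemma ln_nondecreasing (x y : R) : 0 < x -> x <= y -> ln x <= ln y.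
Proof.
  intros Hx [Hxy| <-]; [left; apply ln_increasing|]; lra.
Qed.

Lemma ln_lt_sub_1 (x : R) : 0 < x -> x <> 1 -> ln x < x - 1.
Proof.
  intros Hx Hx1.
  pose proof (exp_ineq1 (ln x) (ln_neq_0 x Hx1 Hx)) as H.
  rewrite exp_ln in H by assumption. lra.
Qed.

(** Both outer values lie above the tangent of [exp] at [y], and the weights cancel its slope
    term. *)
Lemma exp_three_point (x y z : R) : x < y -> y < z ->
  (z - x) * exp y < (z - y) * exp x + (y - x) * exp z.
Proof.
  intros Hxy Hyz.
  replace (exp x) with (exp y * exp (x - y))
    by (rewrite <- exp_plus; f_equal; ring).
  replace (exp z) with (exp y * exp (z - y))
    by (rewrite <- exp_plus; f_equal; ring).
  pose proof (exp_pos y).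
  assert (H1 : 1 + (x - y) < exp (x - y)) by (apply exp_ineq1; lra).
  assert (H2 : 1 + (z - y) < exp (z - y)) by (apply exp_ineq1; lra).
  assert (H3 : z - x < (z - y) * exp (x - y) + (y - x) * exp (z - y)) by nra.
  nra.
Qed.

Lemma derivable_pt_lim_exp_scal (x t : R) : x <> 0 ->
  derivable_pt_lim (fun t => exp (t * x) / x) t (exp (t * x)).
Proof.
  intros Hx.
  replace (exp (t * x)) with (/ x * (exp (t * x) * x)) by (field; lra).
  apply (derivable_pt_lim_ext (mult_real_fct (/ x) (comp exp (fun t => t * x)))).
  - intros u. unfold mult_real_fct, comp. field. lra.
  - apply derivable_pt_lim_scal.
    apply derivable_pt_lim_comp.
    + pose proof (derivable_pt_lim_scal_right id t 1 x (derivable_pt_lim_id t))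
        as H.
      rewrite Rmult_1_l in H. exact H.
    + apply derivable_pt_lim_exp.
Qed.

(** The mean value theorem replaces the integral over [t]: the convexity gap is [G 1 - G l], and
    [G' t] is the gap of [exp (t * _)]. *)
Lemma exp_diff_quot_convex (l : R) : 0 <= l < 1 ->
  strictly_convex_pos (exp_diff_quot l).
Proof.
  intros Hl x y z Hx Hxy Hyz.
  set (G := fun t => (z - y) * (exp (t * x) / x) + (y - x) * (exp (t * z) / z)
                     - (z - x) * (exp (t * y) / y)).
  set (G' := fun t => (z - y) * exp (t * x) + (y - x) * exp (t * z)
                      - (z - x) * exp (t * y)).
  destruct (MVT_cor2 G G' l 1) as [t [Ht Hlt]]; [lra| |].
  - intros t _. unfold G, G'.
    apply (derivable_pt_lim_minus
      (fun t => (z - y) * (exp (t * x) / x) + (y - x) * (exp (t * z) / z))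
      (fun t => (z - x) * (exp (t * y) / y))).
    + apply (derivable_pt_lim_plus (fun t => (z - y) * (exp (t * x) / x))
        (fun t => (y - x) * (exp (t * z) / z)));
      apply (derivable_pt_lim_scal (fun t => exp (t * _) / _));
      apply derivable_pt_lim_exp_scal; lra.
    + apply (derivable_pt_lim_scal (fun t => exp (t * _) / _)).
      apply derivable_pt_lim_exp_scal; lra.
  (* The three points scaled by [t] bring out the factor [t], positive because [0 <= l < t]. *)
  - assert (H : 0 < t * G' t).
    { pose proof (exp_three_point (t * x) (t * y) (t * z)) as H.
      unfold G'. nra. }
    assert (HG : 0 < G 1 - G l) by (rewrite Ht; nra).
    unfold G in HG. rewrite !Rmult_1_l in HG.
    unfold exp_diff_quot, Rdiv in *. lra.
Qed.

Lemma exp_diff_quot_incr (l x y : R) : 0 <= l < 1 -> 0 < x -> x < y ->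
  exp_diff_quot l x < exp_diff_quot l y.
Proof.
  intros Hl Hx Hxy.
  destruct (MVT_cor2 (fun t => exp (t * y) / y - exp (t * x) / x)
    (fun t => exp (t * y) - exp (t * x)) l 1) as [t [Ht Hlt]]; [lra| |].
  - intros t _.
    apply (derivable_pt_lim_minus (fun t => exp (t * y) / y)
      (fun t => exp (t * x) / x)); apply derivable_pt_lim_exp_scal; lra.
  - assert (H : exp (t * x) < exp (t * y)) by (apply exp_increasing; nra).
    rewrite !Rmult_1_l in Ht. unfold exp_diff_quot, Rdiv in *. nra.
Qed.

Lemma exp_diff_quot_pos (l x : R) : l < 1 -> 0 < x -> 0 < exp_diff_quot l x.
Proof.
  intros Hl Hx. apply Rdiv_lt_0_compat; [|assumption].
  assert (exp (l * x) < exp x) by (apply exp_increasing; nra). lra.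
Qed.

(** * Nonnegative mixtures of two such quotients *)

Section Mixture.

Variables alpha u v : R.
Hypotheses (Halpha : 0 < alpha <= 1) (Hu : 0 <= u) (Hv : 0 <= v).

Lemma exp_mix_convex : 0 < u + v -> strictly_convex_pos (exp_mix alpha u v).
Proof.
  intros Huv x y z Hx Hxy Hyz. unfold exp_mix.
  assert (H1 : 0 <= 1 - alpha < 1) by lra.
  assert (H0 : 0 <= 0 < 1) by lra.
  pose proof (exp_diff_quot_convex _ H1 x y z Hx Hxy Hyz) as H.
  pose proof (exp_diff_quot_convex _ H0 x y z Hx Hxy Hyz) as H'.
  destruct (Rle_lt_or_eq_dec _ _ Hu); nra.
Qed.

Lemma exp_mix_nonneg (x : R) : 0 < x -> 0 <= exp_mix alpha u v x.
Proof.
  intros Hx. unfold exp_mix.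
  assert (0 < exp_diff_quot (1 - alpha) x) by (apply exp_diff_quot_pos; lra).
  assert (0 < exp_diff_quot 0 x) by (apply exp_diff_quot_pos; lra).
  nra.
Qed.

Lemma exp_mix_incr (x y : R) : 0 < x -> x <= y ->
  exp_mix alpha u v x <= exp_mix alpha u v y.
Proof.
  intros Hx [Hxy| <-]; [|lra]. unfold exp_mix.
  assert (exp_diff_quot (1 - alpha) x < exp_diff_quot (1 - alpha) y)
    by (apply exp_diff_quot_incr; lra).
  assert (exp_diff_quot 0 x < exp_diff_quot 0 y)
    by (apply exp_diff_quot_incr; lra).
  nra.
Qed.

End Mixture.

(** * Secant intercepts *)

Lemma intercept_sym (f : R -> R) (x y : R) : x <> y ->
  intercept f x y = intercept f y x.
Proof. intros H. unfold intercept. field. split; lra. Qed.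

Lemma intercept_min_max (f : R -> R) (x y : R) : x <> y ->
  intercept f (Rmin x y) (Rmax x y) = intercept f x y.
Proof.
  intros H. unfold Rmin, Rmax. destruct (Rle_dec x y); [reflexivity|].
  apply intercept_sym. lra.
Qed.

(** The difference of the intercepts is [m] times a convexity gap over [(d - m) * (d' - m)]. Gap and
    denominator are both negative when [m] lies between [d] and [d'], and both positive
    otherwise. *)
Lemma intercept_decr (f : R -> R) (m d d' : R) :
  strictly_convex_pos f -> 0 < m -> 0 < d -> d <> m -> d' <> m -> d < d' ->
  intercept f m d' < intercept f m d.
Proof.
  intros Hf Hm Hd Hdm Hdm' Hdd'.
  assert (E : intercept f m d - intercept f m d'
    = m * ((d' - d) * f m + (d - m) * f d' - (d' - m) * f d)
      / ((d - m) * (d' - m)))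
    by (unfold intercept; field; lra).
  enough (0 < intercept f m d - intercept f m d') by lra.
  rewrite E. destruct (Rlt_le_dec m d).
  - pose proof (Hf m d d' Hm ltac:(lra) ltac:(lra)).
    apply Rdiv_lt_0_compat; nra.
  - destruct (Rlt_le_dec m d').
    + pose proof (Hf d m d' Hd ltac:(lra) ltac:(lra)).
      apply Rdiv_neg_neg; nra.
    + pose proof (Hf d d' m Hd ltac:(lra) ltac:(lra)).
      apply Rdiv_lt_0_compat; nra.
Qed.

(** * The estimates in terms of mixtures *)

Lemma exp_mix_mul (alpha u v x : R) : x <> 0 ->
  exp x * (u * (1 - exp (- alpha * x)) + v * (1 - exp (- x)))
  = x * exp_mix alpha u v x.
Proof.
  intros Hx. unfold exp_mix, exp_diff_quot.
  replace (exp ((1 - alpha) * x)) with (exp x * exp (- alpha * x))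
    by (rewrite <- exp_plus; f_equal; ring).
  rewrite Rmult_0_l, exp_0, exp_Ropp.
  pose proof (exp_pos x). field. lra.
Qed.

Lemma b_hat_mix (alpha s p0 x : R) : x <> 0 ->
  b_hat alpha s p0 x = exp_mix alpha s (p0 / 2) x.
Proof.
  intros Hx. unfold b_hat.
  replace (exp_mix _ _ _ _) with (x * exp_mix alpha s (p0 / 2) x / x)
    by (field; lra).
  rewrite <- exp_mix_mul by assumption. rewrite exp_Ropp.
  pose proof (exp_pos x). field. lra.
Qed.

Lemma c_hat_intercept (alpha s p0 x y : R) : 0 < x -> 0 < y -> x <> y ->
  c_hat alpha s p0 x y = intercept (exp_mix alpha (1 - s) (p0 / 2)) x y.
Proof.
  intros Hx Hy Hxy. unfold c_hat.
  rewrite !(Rmult_assoc (_ ^ 2)), !exp_mix_mul by lra.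
  unfold intercept. field. lra.
Qed.

Lemma a_hat_intercept (alpha p0 x y : R) : 0 < x -> 0 < y -> x <> y ->
  a_hat alpha p0 x y = intercept (exp_mix alpha 1 p0) x y.
Proof.
  intros Hx Hy Hxy. unfold a_hat.
  (* The coefficient [u = 1] is made explicit so that [exp_mix_mul] matches. *)
  rewrite <- (Rmult_1_l (1 - exp (- alpha * x))),
    <- (Rmult_1_l (1 - exp (- alpha * y))).
  rewrite !(Rmult_assoc (_ ^ 2)), !exp_mix_mul by lra.
  unfold intercept. field. lra.
Qed.

(** * Gibbs' inequality and the entropy factor *)

Lemma Gibbs_strict (b y q : R) : 0 <= b < y -> 0 < q < 1 -> b / y <> q ->
  b * ln q + (y - b) * ln (1 - q)
    < b * ln (b / y) + (y - b) * ln (1 - b / y).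
Proof.
  intros [[Hb| <-] Hby] Hq Hneq.
  - assert (Hp0 : 0 < b / y) by (apply Rdiv_lt_0_compat; lra).
    assert (Hp1 : 1 - b / y = (y - b) / y) by (field; lra).
    assert (Hp1' : 0 < 1 - b / y)
      by (rewrite Hp1; apply Rdiv_lt_0_compat; lra).
    set (p := b / y) in *.
    assert (Hpb : b = p * y) by (unfold p; field; lra).
    assert (H1 : ln (q / p) < q / p - 1).
    { apply ln_lt_sub_1; [apply Rdiv_lt_0_compat; lra|].
      intros E. apply Hneq. replace q with (q / p * p) by (field; lra).
      rewrite E. ring. }
    assert (H2 : ln ((1 - q) / (1 - p)) < (1 - q) / (1 - p) - 1).
    { apply ln_lt_sub_1; [apply Rdiv_lt_0_compat; lra|].
      intros E. apply Hneq.
      enough (1 - q = 1 - p) by lra.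
      replace (1 - q) with ((1 - q) / (1 - p) * (1 - p)) by (field; lra).
      rewrite E. ring. }
    unfold Rdiv in H1 at 1, H2 at 1.
    rewrite ln_mult, ln_Rinv in H1, H2 by (try apply Rinv_0_lt_compat; lra).
    (* Weighted by [b = p * y] and [y - b], the two linear bounds on the logarithms cancel. *)
    assert (E : b * (q / p - 1) + (y - b) * ((1 - q) / (1 - p) - 1) = 0)
      by (rewrite Hpb; field; lra).
    nra.
  - unfold Rdiv. rewrite !Rmult_0_l, !Rminus_0_r, ln_1.
    assert (ln (1 - q) < 0) by (rewrite <- ln_1; apply ln_increasing; lra).
    nra.
Qed.

Lemma entropy_gain_mul (b y : R) : y <> 0 ->
  y * (1 - binary_entropy (b / y)) * ln 2
  = y * ln 2 + b * ln (b / y) + (y - b) * ln (1 - b / y).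
Proof.
  intros Hy. unfold binary_entropy, log2.
  pose proof ln_lt_2. field. lra.
Qed.

Lemma entropy_gain_0 (y : R) : y * (1 - binary_entropy (0 / y)) = y.
Proof.
  unfold binary_entropy, log2, Rdiv.
  rewrite !Rmult_0_l, Rminus_0_r, ln_1. ring.
Qed.

Lemma entropy_gain_lt (b b' y y' : R) :
  0 <= b <= b' -> y' - b' < y - b -> estimate_valid y' b' ->
  y' * (1 - binary_entropy (b' / y')) < y * (1 - binary_entropy (b / y)).
Proof.
  intros [Hb Hbb'] Hc [Hy' Hq].
  (* For [b' = 0] the ratio is 0, outside the range of [q] in Gibbs' inequality; there both gains
     are just the yields. *)
  destruct (Req_dec b' 0) as [->|Hb'].
  { replace b with 0 in * by lra. rewrite !entropy_gain_0. lra. }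
  assert (Eb' : b' = b' / y' * y') by (field; assumption).
  pose proof ln_lt_2 as Hln2.
  apply (Rmult_lt_reg_r (ln 2)); [lra|].
  assert (Hpos' : 0 < y') by nra.
  assert (Hpos : 0 < y) by nra.
  rewrite !entropy_gain_mul by lra.
  set (q := b' / y') in *.
  assert (Hq0 : 0 < q) by (apply Rdiv_lt_0_compat; lra).
  (* With equal ratios, [(1 - q) * y' < (1 - q) * y] gives [y' < y], hence [b' < b], a
     contradiction. *)
  assert (Hneq : b / y <> q).
  { intros E.
    assert (b = q * y) by (rewrite <- E; field; lra).
    nra. }
  assert (HG := Gibbs_strict b y q ltac:(nra) ltac:(lra) Hneq).
  assert (H1 : ln 2 + ln q <= 0).
  { rewrite <- ln_mult, <- ln_1 by lra. apply ln_nondecreasing; lra. }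
  assert (H2 : 0 <= ln 2 + ln (1 - q)).
  { rewrite <- ln_mult, <- ln_1 by lra. apply ln_nondecreasing; lra. }
  nra.
Qed.

(** * Monotonicity of the two rates *)

(** Serves both rates. The premise [b <= b'] is offered to the drop of [y - b] because for
    [a_hat - b_hat] that drop relies on the growth of [b_hat]. *)
Lemma key_rate_lt (alpha s p0 mu_s d d' y y' : R) :
  0 < alpha <= 1 -> 0 <= s -> 0 <= p0 -> 0 < mu_s -> 0 < d -> d < d' ->
  let b := b_hat alpha s p0 (Rmin mu_s d) in
  let b' := b_hat alpha s p0 (Rmin mu_s d') in
  (b <= b' -> y' - b' < y - b) -> estimate_valid y' b' ->
  mu_s * exp (- mu_s) * y' * (1 - binary_entropy (b' / y'))
    < mu_s * exp (- mu_s) * y * (1 - binary_entropy (b / y)).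
Proof.
  intros Halpha Hs Hp0 Hmu Hd Hdd' b b' Hc Hvalid.
  assert (Hmin : 0 < Rmin mu_s d) by (apply Rmin_glb_lt; lra).
  assert (Hmin' : Rmin mu_s d <= Rmin mu_s d')
    by (apply Rle_min_compat_l; lra).
  assert (Hb : 0 <= b <= b').
  { unfold b, b'. rewrite !b_hat_mix by lra. split.
    - apply exp_mix_nonneg; lra.
    - apply exp_mix_incr; lra. }
  rewrite !(Rmult_assoc (mu_s * _)).
  apply Rmult_lt_compat_l; [apply Rmult_lt_0_compat; [lra|apply exp_pos]|].
  apply entropy_gain_lt; auto. apply Hc, Hb.
Qed.

Theorem theorem2 (alpha s p0 eta mu_s : R)
  (Halpha : 0 < alpha <= 1) (Hs : 0 <= s <= 1) (Hp0 : 0 <= p0)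
  (Hmu_s : 0 < mu_s) :
  (forall mu_d mu_d' : R,
     0 < mu_d -> mu_d <> mu_s -> mu_d' <> mu_s -> mu_d < mu_d' ->
     estimate_valid (yield_Rtilde alpha p0 mu_s mu_d')
                    (b_hat alpha s p0 (Rmin mu_s mu_d')) ->
     key_rate_tilde alpha s p0 eta mu_s mu_d'
       < key_rate_tilde alpha s p0 eta mu_s mu_d)
  /\
  (forall mu_d mu_d' : R,
     0 < mu_d -> mu_d <> mu_s -> mu_d' <> mu_s -> mu_d < mu_d' ->
     estimate_valid (yield_R alpha s p0 mu_s mu_d')
                    (b_hat alpha s p0 (Rmin mu_s mu_d')) ->
     key_rate alpha s p0 eta mu_s mu_d'
       < key_rate alpha s p0 eta mu_s mu_d).
Proof.
  assert (Hmm : forall d, 0 < d -> d <> mu_s ->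
    0 < Rmin mu_s d /\ 0 < Rmax mu_s d /\ Rmin mu_s d <> Rmax mu_s d).
  { intros d Hd Hne. unfold Rmin, Rmax. destruct (Rle_dec mu_s d); lra. }
  split; intros d d' Hd Hne Hne' Hlt Hvalid;
    destruct (Hmm d) as (? & ? & ?), (Hmm d') as (? & ? & ?); try lra.
  - unfold key_rate_tilde.
    apply Rplus_lt_compat_r, Rplus_lt_compat_r.
    apply key_rate_lt; try lra; [|exact Hvalid].
    intros Hb. unfold yield_Rtilde.
    rewrite !a_hat_intercept, !intercept_min_max by auto.
    assert (intercept (exp_mix alpha 1 p0) mu_s d'
      < intercept (exp_mix alpha 1 p0) mu_s d)
      by (apply intercept_decr; auto; apply exp_mix_convex; lra).
    lra.
  - unfold key_rate.
    apply Rplus_lt_compat_r, Rplus_lt_compat_r.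
    apply key_rate_lt; try lra; [|exact Hvalid].
    intros _. unfold yield_R in *.
    rewrite !c_hat_intercept, !intercept_min_max in * by auto.
    (* Subtracting [b_hat] from the yield leaves the bare intercept [c_hat]. *)
    unfold Rminus. rewrite !Rplus_assoc, !Rplus_opp_r, !Rplus_0_r.
    destruct (Req_dec (1 - s + p0 / 2) 0) as [Hdeg|Hdeg].
    + (* Here [s = 1] and [p0 = 0], so the yield is [b] itself and the
         estimated error rate is 1. *)
      exfalso. destruct Hvalid as [Hy [_ Hq]].
      assert (Hc : intercept (exp_mix alpha (1 - s) (p0 / 2)) mu_s d' = 0).
      { replace (1 - s) with 0 by lra. replace (p0 / 2) with 0 by lra.
        unfold intercept, exp_mix. field. lra. }
      rewrite Hc, Rplus_0_l in *.
      rewrite Rdiv_diag in Hq by assumption. lra.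
    + apply intercept_decr; auto. apply exp_mix_convex; lra.
Qed.
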